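(* Let $0<\eta<1$ and consider a one-dimensional stochastic gradient model $g_t=\mu_t+\xi_t$, $t\ge1$, where $\mu_t=\mathbb E[g_t\mid\mathcal F_{t-1}]$ is the (possibly time-varying) true gradient, which is not assumed to be constant or independent of the noise, and the noise satisfies $\mathbb E[\xi_t\mid\mathcal F_{t-1}]=0$ and $\mathrm{Var}(\xi_t\mid\mathcal F_{t-1})=\sigma^2$. Put $v_0=u_0=0$ and for $t\ge0$ $$v_{t+1}=(1-\eta)v_t+\eta g_{t+1},\qquad u_{t+1}=(1-\eta)u_t+\eta v_{t+1}.$$ Conditionally on any realization of $\mu_{1:t}=\{\mu_1,\dots,\mu_t\}$, the centered noise parts are $$\widetilde v_t:=v_t-\mathbb E[v_t\mid\mu_{1:t}]=\eta\sum_{k=0}^{t-1}(1-\eta)^k\xi_{t-k},\qquad \widetilde u_t:=u_t-\mathbb E[u_t\mid\mu_{1:t}]=\eta^2\sum_{r=0}^{t-1}(r+1)(1-\eta)^r\xi_{t-r},$$ with conditional variances $$\mathbb E[\widetilde v_t^2\mid\mu_{1:t}]=\eta^2\sigma^2\sum_{k=0}^{t-1}(1-\eta)^{2k},\qquad \mathbb E[\widetilde u_t^2\mid\mu_{1:t}]=\eta^4\sigma^2\sum_{r=0}^{t-1}(r+1)^2(1-\eta)^{2r}.$$ Letting $t\to\infty$, the limiting conditional noise variances are $$\mathrm{Var}_{\rm noise}(v_\infty\mid\mu_{1:\infty})=\frac{\eta}{2-\eta}\,\sigma^2,\qquad \mathrm{Var}_{\rm noise}(u_\infty\mid\mu_{1:\infty})=\sigma^2\eta\,\frac{2-2\eta+\eta^2}{(2-\eta)^3},$$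 and their ratio satisfies $$\frac{\mathrm{Var}_{\rm noise}(u_\infty\mid\mu_{1:\infty})}{\mathrm{Var}_{\rm noise}(v_\infty\mid\mu_{1:\infty})}=\frac{2-2\eta+\eta^2}{(2-\eta)^2}\in\big[\tfrac12,1\big).$$ Thus the conditional noise variance of the double-momentum estimator is strictly smaller than that of the single-momentum estimator, with an asymptotic reduction factor of about $1/2$ when $\eta$ is small. The time variation of $\mu_t$ affects only the conditional means $\mathbb E[v_t\mid\mu_{1:t}]=\eta\sum_{k=0}^{t-1}(1-\eta)^k\mu_{t-k}$ and $\mathbb E[u_t\mid\mu_{1:t}]=\eta^2\sum_{r=0}^{t-1}(r+1)(1-\eta)^r\mu_{t-r}$, not these variance formulas.
   Context: $\mathcal F_{t-1}$ is the sigma-field generated by all randomness up to time $t-1$, so $(\xi_t)$ is a martingale difference sequence; the general model only requires $\mathrm{Var}(\xi_t\mid\mathcal F_{t-1})\le\sigma^2$, and the exact formulas are for the homoskedastic case with equality. $v_t$ is the single-momentum estimator and $u_t$ the double-momentum estimator. $\mathrm{Var}_{\rm noise}(v_\infty\mid\mu_{1:\infty})$ and $\mathrm{Var}_{\rm noise}(u_\infty\mid\mu_{1:\infty})$ denote the limits as $t\to\infty$ of $\mathbb E[\widetilde v_t^2\mid\mu_{1:t}]$ and $\mathbb E[\widetilde u_t^2\mid\mu_{1:t}]$.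
   Formalization: The conditional claims additionally assume that, for k ≤ t, ξ_k keeps conditional mean 0 and variance σ² given F_{k-1} and μ_{1:t} together; otherwise they can fail, e.g. μ_2=ξ_1. The ratio and strict inequality assume σ≠0. *)

(* Defs.v *)
From mathcomp Require Import all_boot all_order all_algebra.
From mathcomp Require Import all_classical all_reals all_analysis.

Set Implicit Arguments.
Unset Strict Implicit.
Unset Printing Implicit Defensive.

Import Order.TTheory GRing.Theory Num.Theory.
Import numFieldNormedType.Exports.

Local Open Scope classical_set_scope.
Local Open Scope ring_scope.

Section conditional_expectation.
Context {R : realType} {d : measure_display} {Omega : measurableType d}.
Variable P : probability Omega R.

(* Y is a version of E[X | G].  G is meant to be a sub-sigma-algebra of the
   measurable sets; versions agree up to P-null sets. *)
Definition is_cond_exp (G : set_system Omega) (X Y : Omega -> R) : Prop :=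
  [/\ P.-integrable setT (EFin \o X),
      P.-integrable setT (EFin \o Y),
      preimage_set_system setT Y measurable `<=` G
    & forall A, G A ->
        (\int[P]_(w in A) (X w)%:E = \int[P]_(w in A) (Y w)%:E)%E].

(* V is a version of Var(X | G) = E[(X - E[X | G])^2 | G]. *)
Definition is_cond_var (G : set_system Omega) (X V : Omega -> R) : Prop :=
  exists2 m, is_cond_exp G X m
           & is_cond_exp G (fun w => (X w - m w) ^+ 2) V.

End conditional_expectation.

(* Exponential moving average of x_1, x_2, ..., started from 0 at time 0.
   The value x 0 is never used: time indices of data start at 1. *)
Fixpoint ema {R : realType} {Omega : Type} (eta : R) (x : nat -> Omega -> R)
    (t : nat) (w : Omega) : R :=
  if t is s.+1 then (1 - eta) * ema eta x s w + eta * x s.+1 w else 0.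

Definition single_momentum {R : realType} {Omega : Type} (eta : R)
    (g : nat -> Omega -> R) : nat -> Omega -> R := ema eta g.

Definition double_momentum {R : realType} {Omega : Type} (eta : R)
    (g : nat -> Omega -> R) : nat -> Omega -> R :=
  ema eta (single_momentum eta g).

(* The sigma-algebra generated by mu_1, ..., mu_t. *)
Definition drift_sigma {R : realType} {Omega : Type} (mu : nat -> Omega -> R)
    (t : nat) : set_system Omega :=
  <<s [set A | exists2 k, (1 <= k <= t)%N
                        & preimage_set_system setT (mu k) measurable A] >>.

Section gradient_model.
Context {R : realType} {d : measure_display} {Omega : measurableType d}.
Variable P : probability Omega R.

Definition is_filtration (F : nat -> set_system Omega) : Prop :=
  forall t, [/\ sigma_algebra setT (F t),
                F t `<=` measurable & F t `<=` F t.+1].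

(* g_t = mu_t + xi_t for t >= 1, with mu_t = E[g_t | F_(t-1)] and xi a
   homoskedastic martingale difference sequence.  The drift mu_t may depend on
   the past in an arbitrary F_(t-1)-measurable way. *)
Definition gradient_model (F : nat -> set_system Omega)
    (g mu xi : nat -> Omega -> R) (sigma : R) : Prop :=
  is_filtration F /\
  forall t,
    [/\ preimage_set_system setT (g t.+1) measurable `<=` F t.+1,
        forall w, g t.+1 w = mu t.+1 w + xi t.+1 w,
        is_cond_exp P (F t) (g t.+1) (mu t.+1),
        is_cond_exp P (F t) (xi t.+1) (cst 0)
      & is_cond_var P (F t) (xi t.+1) (cst (sigma ^+ 2))].

(* The noise assumptions persist once mu_1, ..., mu_t is conditioned upon: for
   1 <= k <= t, the first two conditional moments of xi_k (with k = s.+1) given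
   the past F_(k-1) are unchanged when mu_(k+1), ..., mu_t are revealed too.
   Without it a later drift may disclose earlier noise (e.g. mu_2 = xi_1, so
   that E[xi_1 | mu_1, mu_2] = xi_1), and the formulas for the moments given
   mu_1, ..., mu_t fail.  It holds for a deterministic drift, and does not
   require mu and xi to be independent. *)
Definition noise_model_given_drift (F : nat -> set_system Omega)
    (mu xi : nat -> Omega -> R) (sigma : R) : Prop :=
  forall s t, (s < t)%N ->
    let G := <<s F s `|` drift_sigma mu t >> in
    is_cond_exp P G (xi s.+1) (cst 0) /\
    is_cond_var P G (xi s.+1) (cst (sigma ^+ 2)).

End gradient_model.

(* Main.v *)
(* If E[X | G] = 0 then E[X Z] = 0 for every G-measurable Z with X Z integrable
   (approximate Z by simple functions).  With Z = xi_r and r < s this makes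
   xi_r and xi_s conditionally uncorrelated, also given mu_1, ..., mu_t once
   those drifts are adjoined to F_(s-1).  Hence the conditional second moment
   of a linear combination of xi_1, ..., xi_t is sigma^2 times the sum of the
   squared coefficients, and both estimators are linear combinations of the
   gradients with explicit coefficients. *)
Require Import Defs.
From mathcomp Require Import all_boot all_order all_algebra.
From mathcomp Require Import all_classical all_reals all_analysis.
From mathcomp Require Import finmap measurable_realfun zify ring lra.

Set Implicit Arguments.
Unset Strict Implicit.
Unset Printing Implicit Defensive.

Import Order.TTheory GRing.Theory Num.Theory.
Import numFieldNormedType.Exports HBSimple HBNNSimple.

Local Open Scope classical_set_scope.
Local Open Scope ring_scope.

(** * Measurability with respect to a sub-sigma-algebra *)

Definition adapted {R : realType} {Omega : Type} (G : set_system Omega)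
    (f : Omega -> R) : Prop :=
  preimage_set_system setT f measurable `<=` G.

Section adapted.
Context {R : realType} {d : measure_display} {Omega : measurableType d}.
Implicit Types (G : set_system Omega) (f X Z : Omega -> R).

(** Viewing [Omega] as [g_sigma_algebraType G] makes the closure rules for measurable functions
    available for [G]; [adapted] itself has the form of the third clause of [is_cond_exp]. *)
Lemma adapted_measurable_fun G f : sigma_algebra setT G -> adapted G f <->
  measurable_fun setT (f : g_sigma_algebraType G -> R).
Proof.
move=> sG; split=> [fG _ Y mY|mf _ [Y mY <-]].
  by rewrite measurable_g_measurableTypeE//; apply: fG; exists Y.
by rewrite -(measurable_g_measurableTypeE sG); exact: mf.
Qed.

Lemma adapted_sub G H f : H `<=` G -> adapted H f -> adapted G f.
Proof. by move=> HG fH A /fH /HG. Qed.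

Lemma adapted_cst G (c : R) : sigma_algebra setT G -> adapted G (cst c).
Proof. by move=> sG; apply/(adapted_measurable_fun _ sG). Qed.

Lemma measurable_funT_adapted G f : G `<=` measurable ->
  adapted G f -> measurable_fun setT f.
Proof. by move=> Gm fG _ Y mY; apply/Gm/fG; exists Y. Qed.

End adapted.

(** * Conditional expectation and variance: calculus and almost sure uniqueness *)

Section cond_exp.
Context {R : realType} {d : measure_display} {Omega : measurableType d}.
Variable P : probability Omega R.
Implicit Types (G H : set_system Omega) (f X Y Z : Omega -> R).

(** Indicators of sets of [G] are covered by the definition, simple functions by linearity, [Z >= 0]
    by dominated convergence, and the general case by splitting [Z] into positive and negative
    parts. *)
Lemma integral_cond_exp0_mulr G X Z :
  sigma_algebra setT G -> G `<=` measurable ->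
  is_cond_exp P G X (cst 0) -> adapted G Z ->
  P.-integrable setT (EFin \o (fun w => X w * Z w)) ->
  (\int[P]_w (X w * Z w)%:E = 0)%E.
Proof.
move=> sG Gm [iX _ _ X0] aZ iZ.
have mX : measurable_fun setT X by apply/measurable_EFinP/(measurable_int P).
have X1 A : G A -> (\int[P]_w (X w * \1_A w)%:E = 0)%E.
  move=> GA; have := X0 _ GA; rewrite integral0 => <-.
  rewrite [RHS]integral_mkcond; apply: eq_integral => w _.
  by rewrite patchE indicE; case: ifPn => _; rewrite ?mulr1 ?mulr0.
have iX1 A : G A -> P.-integrable setT (EFin \o (fun w => X w * \1_A w)).
  move=> /Gm mA; apply: le_integrable iX => //.
    by apply/measurable_EFinP; apply: measurable_funM.
  move=> w _ /=; rewrite lee_fin normrM ler_piMr// indicE.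
  by case: (_ \in _); rewrite ?normr1 ?normr0.
(* Simple functions on [g_sigma_algebraType G] have their level sets in [G], so [X1] applies to each
   term. *)
have Xsimple (h : {nnsfun (g_sigma_algebraType G) >-> R}) :
    (\int[P]_w (X w * h w)%:E = 0)%E.
  pose A (i : nat) := h @^-1` [set (fset_set (range h))`_i].
  have GA i : G (A i).
    by rewrite -(measurable_g_measurableTypeE sG); exact: measurable_sfunP.
  under eq_integral do rewrite fimfunEord mulr_sumr.
  rewrite (eq_integral (fun w => \sum_(i < #|`fset_set (range h)|)
    (((fset_set (range h))`_i)%:E * (X w * \1_(A i) w)%:E)))%E; last first.
    by move=> w _; rewrite -sumEFin; apply: eq_bigr => i _;
       rewrite -EFinM mulrCA.
  rewrite integral_sum//; last by move=> i; apply/integrableZl/iX1.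
  by rewrite big1// => i _; rewrite integralZl ?X1 ?mule0//; exact: iX1.
have Xge0 Z' : adapted G Z' -> (forall w, 0 <= Z' w) ->
    P.-integrable setT (EFin \o (fun w => X w * Z' w)) ->
    (\int[P]_w (X w * Z' w)%:E = 0)%E.
  move=> aZ' Z0 iZ'.
  have mZ' : measurable_fun (setT : set (g_sigma_algebraType G)) (EFin \o Z').
    exact/measurable_EFinP/(adapted_measurable_fun _ sG).
  pose h n : {nnsfun (g_sigma_algebraType G) >-> R} :=
    nnsfun_approx measurableT mZ' n.
  have mh n : measurable_fun setT (h n : Omega -> R).
    apply: (measurable_funT_adapted Gm).
    exact/(adapted_measurable_fun _ sG)/measurable_funPT.
  have cvgh w : h n w @[n --> \oo] --> Z' w.
    have := @cvg_nnsfun_approx _ _ _ _ measurableT _ mZ' _ w.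
    by move=> /(_ (fun x _ => Z0 x) I)/fine_cvg.
  have leh n w : h n w <= Z' w.
    have ndh : nondecreasing_seq (fun n => h n w).
      by move=> m k /(nd_nnsfun_approx measurableT mZ')/lefP; exact.
    rewrite -(cvg_lim _ (cvgh w))//; apply: nondecreasing_cvgn_le => //.
    by apply/cvg_ex; exists (Z' w); exact: cvgh.
  (* The approximations lie between 0 and [Z'], so [|X Z'|] dominates every [|X h_n|]. *)
  have [] := @dominated_convergence _ _ _ P setT measurableT
    (fun n w => (X w * h n w)%:E) (fun w => (X w * Z' w)%:E)
    (fun w => `|X w * Z' w|%:E).
  - by move=> n; exact/measurable_EFinP/measurable_funM.
  - exact: measurable_int iZ'.
  - apply: aeW => w _; apply: cvg_EFin; first exact: nearW.
    by apply: cvgM (cvgh w); exact: cvg_cst.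
  - exact: integrable_norm iZ'.
  - apply: aeW => w n _; rewrite lee_fin !normrM ler_wpM2l//.
    by rewrite !ger0_norm.
  - move=> _ _; under eq_fun do rewrite Xsimple.
    by move=> /(cvg_lim (@ereal_hausdorff R)) <-; rewrite lim_cst.
have mZ : measurable_fun setT Z by exact: measurable_funT_adapted aZ.
have mp : measurable_fun setT (fun w => Num.max (Z w) 0).
  by apply: measurable_maxr.
have mn : measurable_fun setT (fun w => Num.max (- Z w) 0).
  by apply: measurable_maxr => //; exact: measurableT_comp.
have gZ : measurable_fun setT (Z : g_sigma_algebraType G -> R).
  exact/adapted_measurable_fun.
have ap : adapted G (fun w => Num.max (Z w) 0).
  by apply/adapted_measurable_fun => //; exact: measurable_maxr.
have an : adapted G (fun w => Num.max (- Z w) 0).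
  apply/adapted_measurable_fun => //; apply: measurable_maxr => //.
  exact: measurableT_comp.
(* Both parts of [Z] are bounded by [|Z|], hence their products with [X] inherit integrability from
   [X Z]. *)
have ip : P.-integrable setT (EFin \o (fun w => X w * Num.max (Z w) 0)).
  apply: le_integrable iZ => //; first exact/measurable_EFinP/measurable_funM.
  move=> w _ /=; rewrite lee_fin !normrM ler_wpM2l//.
  by rewrite ger0_norm ?le_max ?lexx ?orbT// ge_max ler_norm normr_ge0.
have in' : P.-integrable setT (EFin \o (fun w => X w * Num.max (- Z w) 0)).
  apply: le_integrable iZ => //; first exact/measurable_EFinP/measurable_funM.
  move=> w _ /=; rewrite lee_fin !normrM ler_wpM2l//.
  rewrite ger0_norm ?le_max ?lexx ?orbT// ge_max normr_ge0 andbT.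
  by rewrite -normrN ler_norm.
rewrite (eq_integral (fun w => (X w * Num.max (Z w) 0)%:E -
    (X w * Num.max (- Z w) 0)%:E))%E; last first.
  move=> w _; rewrite -EFinB -mulrBr; congr (_ * _)%:E.
  by case: (leP (Z w) 0) => Z0; case: (leP (- Z w) 0) => //; lra.
rewrite (integralB measurableT ip in')/=.
by rewrite !Xge0// ?subee// => w; rewrite le_max lexx orbT.
Qed.

Lemma cond_exp_lin G X X' Y Y' (a b : R) :
  sigma_algebra setT G -> G `<=` measurable ->
  is_cond_exp P G X Y -> is_cond_exp P G X' Y' ->
  is_cond_exp P G (fun w => a * X w + b * X' w) (fun w => a * Y w + b * Y' w).
Proof.
move=> sG Gm [iX iY aY XY] [iX' iY' aY' XY'].
have iZD (f f' : Omega -> R) (D : set Omega) : measurable D ->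
    P.-integrable D (EFin \o f) -> P.-integrable D (EFin \o f') ->
    P.-integrable D (EFin \o (fun w => a * f w + b * f' w)).
  by move=> mD jf jf'; exact: (integrableD mD (integrableZl mD a jf)
                                              (integrableZl mD b jf')).
have intZD (f f' : Omega -> R) (D : set Omega) : measurable D ->
    P.-integrable D (EFin \o f) -> P.-integrable D (EFin \o f') ->
    (\int[P]_(w in D) (a * f w + b * f' w)%:E =
     a%:E * \int[P]_(w in D) (f w)%:E + b%:E * \int[P]_(w in D) (f' w)%:E)%E.
  move=> mD jf jf'.
  rewrite -!integralZl// -integralD//; exact: integrableZl.
split; [exact: iZD|exact: iZD| |].
- apply/adapted_measurable_fun => //.
  apply: measurable_funD; apply: measurable_funM => //;
    exact/adapted_measurable_fun.
- move=> A GA; have mA := Gm _ GA.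
  rewrite !intZD ?XY ?XY'//; exact: (integrableS measurableT).
Qed.

Lemma cond_exp_cst G (c : R) : sigma_algebra setT G ->
  is_cond_exp P G (cst c) (cst c).
Proof.
move=> sG; split => //; [exact: finite_measure_integrable_cst..|].
exact: adapted_cst.
Qed.

Lemma cond_exp_sum G (n : nat) (X Y : 'I_n -> Omega -> R) :
  sigma_algebra setT G -> G `<=` measurable ->
  (forall i, is_cond_exp P G (X i) (Y i)) ->
  is_cond_exp P G (fun w => \sum_(i < n) X i w) (fun w => \sum_(i < n) Y i w).
Proof.
move=> sG Gm; elim: n => [|n IH] in X Y * => XY.
  under eq_fun do rewrite big_ord0.
  under [X in is_cond_exp _ _ _ X]eq_fun do rewrite big_ord0.
  exact: cond_exp_cst.
under eq_fun do rewrite big_ord_recl -[X in X + _]mul1r -[X in _ + X]mul1r.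
under [X in is_cond_exp _ _ _ X]eq_fun do
  rewrite big_ord_recl -[X in X + _]mul1r -[X in _ + X]mul1r.
by apply: cond_exp_lin => //; exact: IH.
Qed.

(** A case of the tower property: since [Y] is already [H]-measurable, it only has to be tested on
    fewer sets. *)
Lemma cond_exp_sub G H X Y : H `<=` G -> adapted H Y ->
  is_cond_exp P G X Y -> is_cond_exp P H X Y.
Proof. by move=> HG aY [iX iY _ XY]; split=> // A /HG /XY. Qed.

(** Integrating over a set [A] of [G] amounts to replacing [Z] by [Z 1_A], which is still
    [G]-measurable. *)
Lemma cond_exp0_mulr G X Z :
  sigma_algebra setT G -> G `<=` measurable ->
  is_cond_exp P G X (cst 0) -> adapted G Z ->
  P.-integrable setT (EFin \o (fun w => X w * Z w)) ->
  is_cond_exp P G (fun w => X w * Z w) (cst 0).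
Proof.
move=> sG Gm X0 aZ iXZ; have [_ i0 a0 _] := X0; split=> // A GA.
have mA := Gm _ GA.
have aZA : adapted G (fun w => Z w * \1_A w).
  apply/adapted_measurable_fun => //; apply: measurable_funM.
    exact/adapted_measurable_fun.
  by apply: measurable_indic; rewrite measurable_g_measurableTypeE.
rewrite integral0 -[RHS](integral_cond_exp0_mulr sG Gm X0 aZA).
  rewrite integral_mkcond; apply: eq_integral => w _.
  by rewrite patchE indicE; case: ifPn => _; rewrite ?mulr1 ?mulr0.
have mXZ : measurable_fun setT (fun w => X w * Z w).
  by apply/measurable_EFinP; exact: measurable_int iXZ.
apply: le_integrable iXZ => //.
  apply/measurable_EFinP; under eq_fun do rewrite mulrA.
  by apply: measurable_funM => //; exact: measurable_indic.
move=> w _ /=; rewrite lee_fin mulrA normrM ler_piMr// indicE.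
by case: (_ \in _); rewrite ?normr1 ?normr0.
Qed.

(** The difference [D] of two versions is [G]-measurable with conditional expectation zero, so it
    may be tested against functions of itself. *)
Lemma cond_exp_unique G X Y Y' :
  sigma_algebra setT G -> G `<=` measurable ->
  is_cond_exp P G X Y -> is_cond_exp P G X Y' ->
  {ae P, forall w, Y w = Y' w}.
Proof.
move=> sG Gm XY XY'.
have [iX iY aY eY] := XY; have [_ iY' aY' eY'] := XY'.
pose D w := Y w - Y' w.
have iD : P.-integrable setT (EFin \o D).
  exact: (integrableB measurableT iY iY').
have aD : adapted G D.
  by apply/adapted_measurable_fun => //; apply: measurable_funB;
    exact/adapted_measurable_fun.
have D0 : is_cond_exp P G D (cst 0).
  have [_ i0 a0 _] := cond_exp_cst 0 sG; split=> // A GA.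
  have mA := Gm _ GA.
  have jY : P.-integrable A (EFin \o Y) by exact: (integrableS measurableT).
  have jY' : P.-integrable A (EFin \o Y') by exact: (integrableS measurableT).
  rewrite integral0.
  transitivity (\int[P]_(w in A) ((EFin \o Y) \- (EFin \o Y')) w)%E.
    by apply: eq_integral => w _.
  rewrite integralB//= -(eY _ GA) -(eY' _ GA) subee//.
  by apply: integrable_fin_num => //; exact: (integrableS measurableT).
(* Testing D against its sign gives E|D| = 0. *)
pose Z w : R := if 0 <= D w then 1 else -1.
have aZ : adapted G Z.
  apply/adapted_measurable_fun => //; apply: measurable_fun_ifT => //.
  apply: measurable_fun_ler => //; exact/adapted_measurable_fun.
have DZ w : D w * Z w = `|D w|.
  rewrite /Z; case: (leP 0 (D w)) => Dw; first by rewrite mulr1 ger0_norm.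
  by rewrite mulrN1 ltr0_norm.
have iDZ : P.-integrable setT (EFin \o (fun w => D w * Z w)).
  by under eq_fun do rewrite DZ; exact: integrable_norm.
have := integral_cond_exp0_mulr sG Gm D0 aZ iDZ.
under eq_integral do rewrite DZ.
move=> /(ae_eq_integral_abs P measurableT (measurable_int P iD)).
apply: filterS => w /(_ I) /= [] Dw.
by apply/eqP; rewrite -subr_eq0; apply/eqP.
Qed.

(** Integrals ignore null sets; measurability of [X'] is a separate hypothesis because [P] need not
    be complete. *)
Lemma cond_exp_ae G X X' Y : G `<=` measurable ->
  measurable_fun setT X' -> {ae P, forall w, X w = X' w} ->
  is_cond_exp P G X Y -> is_cond_exp P G X' Y.
Proof.
move=> Gm mX' XX' [iX iY aY XY].
have mX := measurable_int P iX.
have eX D : measurable D ->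
    (\int[P]_(w in D) (X w)%:E = \int[P]_(w in D) (X' w)%:E)%E.
  move=> mD; apply: ae_eq_integral => //.
  - exact: measurable_funTS.
  - exact/measurable_funTS/measurable_EFinP.
  - by apply: filterS XX' => w ->.
split=> //; last by move=> A GA; rewrite -eX ?XY//; exact: Gm.
apply/integrableP; split; first exact/measurable_EFinP.
have /integrableP[_] := iX; rewrite (ae_eq_integral (abse \o EFin \o X'))//.
- exact: measurableT_comp.
- by do 2 apply: measurableT_comp => //.
- by apply: filterS XX' => w /= ->.
Qed.

(** [is_cond_var] hides the conditional mean behind an existential; uniqueness lets any known
    version replace it, in particular 0 for the noise. *)
Lemma cond_var_cond_exp G X m V :
  sigma_algebra setT G -> G `<=` measurable -> is_cond_exp P G X m ->
  is_cond_var P G X V -> is_cond_exp P G (fun w => (X w - m w) ^+ 2) V.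
Proof.
move=> sG Gm Xm [m' Xm'].
apply: cond_exp_ae => //.
  have [iX im _ _] := Xm.
  by apply: measurable_funX; apply: measurable_funB;
    apply/measurable_EFinP/(measurable_int P).
by apply: filterS (cond_exp_unique sG Gm Xm' Xm) => w ->.
Qed.

Lemma cond_var_unique G X V V' :
  sigma_algebra setT G -> G `<=` measurable ->
  is_cond_var P G X V -> is_cond_var P G X V' -> {ae P, forall w, V w = V' w}.
Proof.
move=> sG Gm [m Xm XV] /(cond_var_cond_exp sG Gm Xm) XV'.
exact: cond_exp_unique XV XV'.
Qed.

(** * Conditional moments of weighted sums of noise *)

Lemma cond_moments_sum G (n : nat) (x : 'I_n -> Omega -> R) (c : 'I_n -> R)
    (sigma : R) :
  sigma_algebra setT G -> G `<=` measurable ->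
  (forall i, is_cond_exp P G (x i) (cst 0)) ->
  (forall i, is_cond_exp P G (fun w => x i w ^+ 2) (cst (sigma ^+ 2))) ->
  (forall i j, i != j -> is_cond_exp P G (fun w => x i w * x j w) (cst 0)) ->
  let S w := \sum_(i < n) c i * x i w in
  is_cond_exp P G S (cst 0) /\
  is_cond_exp P G (fun w => S w ^+ 2) (cst (sigma ^+ 2 * \sum_(i < n) c i ^+ 2)).
Proof.
move=> sG Gm x1 x2 xx S.
have cZ X y (a : R) : is_cond_exp P G X (cst y) ->
    is_cond_exp P G (fun w => a * X w) (cst (a * y)).
  move=> Xy; have := cond_exp_lin a 0 sG Gm Xy (cond_exp_cst 0 sG).
  by under eq_fun do rewrite mul0r addr0;
     under [X in is_cond_exp _ _ _ X]eq_fun do rewrite mul0r addr0.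
split.
  rewrite (_ : cst 0 = fun w => \sum_(i < n) cst (c i * 0) w); last first.
    by apply/funext => w; rewrite big1// => i _; rewrite /= mulr0.
  by apply: cond_exp_sum => // i; exact: cZ.
(* The square becomes a double sum, and the target constant a double sum of the same shape in which
   only the diagonal survives. *)
rewrite (_ : (fun w => _) =
    fun w => \sum_(i < n) \sum_(j < n) (c i * c j) * (x i w * x j w)); last first.
  apply/funext => w; rewrite expr2 mulr_suml; apply: eq_bigr => i _.
  by rewrite mulr_sumr; apply: eq_bigr => j _; rewrite mulrACA.
rewrite (_ : cst _ = fun w : Omega => \sum_(i < n) \sum_(j < n)
    cst (if i == j then c i * c j * sigma ^+ 2 else c i * c j * 0) w); last first.
  apply/funext => w; rewrite mulr_sumr; apply: eq_bigr => i _.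
  rewrite (bigD1 i)//= eqxx big1 ?addr0 => [|j]; first by rewrite mulrC -expr2.
  by rewrite eq_sym => /negbTE ->; rewrite mulr0.
apply: cond_exp_sum => // i; apply: cond_exp_sum => // j.
by case: eqVneq => [->|ij]; apply: cZ; [exact: x2|exact: xx].
Qed.

(** [Gs s] plays the role of the past of [xi s.+1], and [G] lies below all these pasts. It serves
    twice: with the filtration above [F 0], and with the filtration enlarged by the drifts above
    [drift_sigma mu t]. *)
Lemma cond_moments_noise_sum (Gs : nat -> set_system Omega) G
    (xi : nat -> Omega -> R) (sigma : R) (t : nat) (c : nat -> R) :
  sigma_algebra setT G -> G `<=` measurable ->
  (forall s, (s < t)%N -> [/\ sigma_algebra setT (Gs s), Gs s `<=` measurable,
     G `<=` Gs s, is_cond_exp P (Gs s) (xi s.+1) (cst 0)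
   & is_cond_var P (Gs s) (xi s.+1) (cst (sigma ^+ 2))]) ->
  (forall r s, (r < s < t)%N -> adapted (Gs s) (xi r.+1)) ->
  let S w := \sum_(k < t) c k * xi (t - k)%N w in
  is_cond_exp P G S (cst 0) /\
  is_cond_exp P G (fun w => S w ^+ 2) (cst (sigma ^+ 2 * \sum_(k < t) c k ^+ 2)).
Proof.
move=> sG Gm hGs axi.
have sub X (y : R) s : (s < t)%N ->
    is_cond_exp P (Gs s) X (cst y) -> is_cond_exp P G X (cst y).
  by move=> /hGs[_ _ GG _ _]; apply: cond_exp_sub => //; exact: adapted_cst.
have xi2 s : (s < t)%N ->
    is_cond_exp P (Gs s) (fun w => xi s.+1 w ^+ 2) (cst (sigma ^+ 2)).
  move=> st; have [sGs Gsm _ x0 xv] := hGs _ st.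
  have := cond_var_cond_exp sGs Gsm x0 xv.
  by under eq_fun do rewrite subr0.
(* The earlier noise is [Gs s]-measurable, hence a factor that can be pulled out next to the later,
   centered one. *)
have xixi r s : (r < s < t)%N ->
    is_cond_exp P G (fun w => xi s.+1 w * xi r.+1 w) (cst 0).
  move=> /[dup] /axi ar /andP[rs st].
  have [sGs Gsm _ x0 _] := hGs _ st.
  apply: sub (st) _; apply: cond_exp0_mulr => //.
  have [i2s _ _ _] := xi2 _ st; have [i2r _ _ _] := xi2 _ (ltn_trans rs st).
  have [i1s _ _ _] := x0.
  (* The product is integrable because [|a b| <= a^2 + b^2]. *)
  apply: le_integrable (integrableD measurableT i2s i2r) => //.
    apply/measurable_EFinP/measurable_funM.
      exact/measurable_EFinP/(measurable_int P).
    exact: measurable_funT_adapted ar.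
  move=> w _ /=; rewrite lee_fin.
  have le_prod (a b : R) : `|a * b| <= `|a ^+ 2 + b ^+ 2|.
    rewrite [leRHS]ger0_norm ?addr_ge0 ?sqr_ge0// ler_norml.
    have hD := sqr_ge0 (a + b); have hB := sqr_ge0 (a - b).
    have ha := sqr_ge0 a; have hb := sqr_ge0 b.
    by apply/andP; split; lra.
  exact: le_prod.
(* As [k < t], the time [t - k] is at least 1, so [xi 0] never occurs. *)
have tk (k : 'I_t) : exists2 s, (s < t)%N & (t - k)%N = s.+1.
  by exists (t - k).-1; have := ltn_ord k; lia.
apply: cond_moments_sum => // [k|k|i j ij].
- by have [s st ->] := tk k; have [_ _ _ x0 _] := hGs _ st; exact: sub st x0.
- by have [s st ->] := tk k; exact: sub st (xi2 _ st).
- have [si sit ei] := tk i; have [sj sjt ej] := tk j; rewrite ei ej.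
  have [ltij|ltji|eij] := ltngtP si sj.
  + by under eq_fun do rewrite mulrC; apply: xixi; rewrite ltij.
  + by apply: xixi; rewrite ltji.
  + by case/eqP: ij; apply: ord_inj; have := ltn_ord i; have := ltn_ord j; lia.
Qed.

End cond_exp.

(** * Closed forms of the moving averages *)

Section ema.
Context {R : realType} {Omega : Type}.
Implicit Types (eta : R) (x : nat -> Omega -> R).

Lemma single_momentumE eta x t w :
  single_momentum eta x t w =
  eta * \sum_(k < t) (1 - eta) ^+ k * x (t - k)%N w.
Proof.
rewrite /single_momentum; elim: t => [|t IH] /=.
  by rewrite big_ord0 mulr0.
rewrite IH big_ord_recl expr0 mul1r subn0 [RHS]mulrDr addrC; congr (_ + _).
rewrite mulrCA mulr_sumr; congr (_ * _); apply: eq_bigr => k _.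
by rewrite exprS mulrA.
Qed.

(** In the inductive step the datum of age [k + 1] gets [k + 1] from the old average and 1 from the
    new [v], both times [(1 - eta)^(k + 1)]; hence the weight [k + 2]. *)
Lemma double_momentumE eta x t w :
  double_momentum eta x t w =
  eta ^+ 2 * \sum_(r < t) r.+1%:R * (1 - eta) ^+ r * x (t - r)%N w.
Proof.
rewrite /double_momentum; elim: t => [|t IH]; first by rewrite big_ord0 mulr0.
rewrite -[LHS]/((1 - eta) * ema eta (single_momentum eta x) t w +
  eta * single_momentum eta x t.+1 w) IH single_momentumE.
rewrite (mulrA eta) -expr2 mulrCA -mulrDr.
congr (_ * _); rewrite [in LHS]big_ord_recl [in RHS]big_ord_recl addrCA.
congr (_ + _); first by rewrite /= expr0 !mul1r.
rewrite mulr_sumr -big_split; apply: eq_bigr => k _ /=.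
rewrite /bump add1n subSS exprS [in RHS]mulrSr.
by ring.
Qed.

End ema.

(** * Geometric sums, plain and with weights [(k + 1)^2] *)

Section series.
Context {R : realType}.
Implicit Types (q : R) (n : nat).

Lemma sum_geometric q n : (1 - q) * \sum_(k < n) q ^+ k = 1 - q ^+ n.
Proof. by rewrite -[RHS]opprB subrX1 -mulNr opprB. Qed.

(** Clearing the denominator [(1 - q)^3] leaves a polynomial identity, proved by induction, with an
    explicit remainder of order [n^2 q^n]. *)
Lemma sum_sqr_geometric q n :
  (1 - q) ^+ 3 * \sum_(k < n) k.+1%:R ^+ 2 * q ^+ k =
  1 + q - q ^+ n * ((1 - q) ^+ 2 * n%:R ^+ 2 + 2 * (1 - q) * n%:R + 1 + q).
Proof.
elim: n => [|n IH]; first by rewrite big_ord0 expr0; ring.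
rewrite big_ord_recr /= mulrDr IH (exprS q n) -natr1.
by ring.
Qed.

(** With [q = s^2] and [s = t^2], one has [n^2 q^n = (n t^n)^2 s^n], where [n t^n] is bounded and
    [s^n] tends to 0. *)
Lemma cvg_sqr_mul_geometric0 q : 0 < q < 1 ->
  n%:R ^+ 2 * q ^+ n @[n --> \oo] --> (0 : R).
Proof.
move=> /andP[q0 q1].
have sqrt01 (x : R) : 0 < x -> x < 1 -> 0 < Num.sqrt x < 1.
  by move=> x0 x1; rewrite sqrtr_gt0 x0 -sqrtr1 ltr_sqrt.
have /andP[s0 s1] := sqrt01 _ q0 q1.
have /andP[t0 t1] := sqrt01 _ s0 s1.
set s := Num.sqrt q in s0 s1 t0 t1; set t := Num.sqrt s in t0 t1.
have [q0' s0' t0' t1'] : [/\ 0 <= q, 0 <= s, 0 <= t & t <= 1] by rewrite !ltW.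
have st : s = t ^+ 2 by rewrite sqr_sqrtr.
have qs : q = s ^+ 2 by rewrite sqr_sqrtr.
(* [n * t ^+ n <= 1 + t + ... + t ^+ n.-1 <= (1 - t)^-1] *)
have bnd n : n%:R * t ^+ n <= (1 - t)^-1.
  rewrite -[leRHS]mul1r ler_pdivlMr ?subr_gt0// mulrC.
  apply: (@le_trans _ _ (1 - t ^+ n)); last by rewrite gerBl exprn_ge0.
  rewrite -sum_geometric ler_wpM2l ?subr_ge0//.
  rewrite mulr_natl -[X in _ *+ X](card_ord n) -sumr_const ler_sum// => k _.
  by apply: ler_wiXn2l => //; exact: ltnW.
apply: (@squeeze_cvgr _ _ _ _ (cst 0) (fun n => (1 - t)^-1 ^+ 2 * s ^+ n)).
- near=> n; rewrite mulr_ge0 ?sqr_ge0 ?exprn_ge0//=.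
  have -> : n%:R ^+ 2 * q ^+ n = (n%:R * t ^+ n) ^+ 2 * s ^+ n.
    rewrite [in LHS]qs st.
    have -> : t ^+ 2 ^+ 2 ^+ n = (t ^+ n) ^+ 2 * (t ^+ 2) ^+ n.
      by rewrite -!exprM -exprD; congr (t ^+ _); lia.
    by rewrite mulrA -exprMn.
  rewrite ler_wpM2r ?exprn_ge0// lerXn2r ?nnegrE//.
  - by rewrite mulr_ge0// exprn_ge0.
  - by rewrite invr_ge0 subr_ge0.
- exact: cvg_cst.
- rewrite -(mulr0 ((1 - t)^-1 ^+ 2)); apply: cvgM; first exact: cvg_cst.
  by apply: cvg_expr; rewrite ger0_norm.
Unshelve. all: by end_near.
Qed.

Lemma cvg_sum_geometric q : 0 < q < 1 ->
  \sum_(k < n) q ^+ k @[n --> \oo] --> (1 - q)^-1.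
Proof.
move=> /andP[q0 q1]; have q_neq : 1 - q != 0 by rewrite subr_eq0 gt_eqF.
have -> : (fun n => \sum_(k < n) q ^+ k) = (fun n => (1 - q)^-1 * (1 - q ^+ n)).
  by apply/funext => n; rewrite -sum_geometric mulKf.
have : (1 - q)^-1 * (1 - q ^+ n) @[n --> \oo] --> (1 - q)^-1 * (1 - 0).
  apply: cvgM; first exact: cvg_cst.
  apply: cvgB; first exact: cvg_cst.
  by apply: cvg_expr; rewrite ger0_norm// ltW.
by rewrite subr0 mulr1.
Qed.

Lemma cvg_sum_sqr_geometric q : 0 < q < 1 ->
  \sum_(k < n) k.+1%:R ^+ 2 * q ^+ k @[n --> \oo] --> (1 + q) / (1 - q) ^+ 3.
Proof.
move=> /[dup] q01 /andP[q0 q1].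
have q_neq : (1 - q) ^+ 3 != 0 by rewrite expf_neq0// subr_eq0 gt_eqF.
have cq : q ^+ n @[n --> \oo] --> (0 : R).
  by apply: cvg_expr; rewrite ger0_norm// ltW.
have cn2 := cvg_sqr_mul_geometric0 q01.
(* Squeezed under the previous limit, since [n <= n^2] for natural [n]. *)
have cn : n%:R * q ^+ n @[n --> \oo] --> (0 : R).
  apply: (@squeeze_cvgr _ _ _ _ (cst 0) (fun n => n%:R ^+ 2 * q ^+ n)) => //.
    near=> n; rewrite mulr_ge0 ?exprn_ge0 ?(ltW q0)//=.
    rewrite ler_wpM2r ?exprn_ge0 ?(ltW q0)// -natrX ler_nat.
    by case: (n) => // m; rewrite leq_pmulr.
  exact: cvg_cst.
have -> : (fun n => \sum_(k < n) k.+1%:R ^+ 2 * q ^+ k) =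
    (fun n => ((1 - q) ^+ 3)^-1 * (1 + q -
      ((1 - q) ^+ 2 * (n%:R ^+ 2 * q ^+ n) + 2 * (1 - q) * (n%:R * q ^+ n) +
       (1 + q) * q ^+ n))).
  apply/funext => n.
  by apply: (mulfI q_neq); rewrite sum_sqr_geometric mulVKf//; ring.
rewrite (_ : (1 + q) / (1 - q) ^+ 3 = ((1 - q) ^+ 3)^-1 * (1 + q -
    ((1 - q) ^+ 2 * 0 + 2 * (1 - q) * 0 + (1 + q) * 0))); last first.
  by rewrite !mulr0 !addr0 subr0 mulrC.
apply: cvgM; first exact: cvg_cst.
apply: cvgB; first exact: cvg_cst.
by apply: cvgD; [apply: cvgD|]; apply: cvgM => //; exact: cvg_cst.
Unshelve. all: by end_near. Qed.

End series.

(** * Noise and drift in the gradient model *)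

Section gradient_model.
Context {R : realType} {d : measure_display} {Omega : measurableType d}.
Variables (P : probability Omega R) (F : nat -> set_system Omega).
Variables (g mu xi : nat -> Omega -> R) (sigma : R).
Hypothesis hmodel : gradient_model P F g mu xi sigma.
Implicit Types (c : nat -> R) (t : nat).

Lemma filtration_le r s : (r <= s)%N -> F r `<=` F s.
Proof.
have [hF _] := hmodel.
elim: s => [|s IH]; first by rewrite leqn0 => /eqP ->.
rewrite leq_eqVlt => /predU1P[->//|rs].
by apply: (subset_trans (IH rs)); have [] := hF s.
Qed.

(** The model states no adaptedness of the noise; it comes from [xi = g - mu], with [g] adapted and
    [mu] predictable. *)
Lemma adapted_noise r s : (r < s)%N -> adapted (F s) (xi r.+1).
Proof.
move=> rs; have [hF hM] := hmodel.
have [gF gE [_ _ muF _] _ _] := hM r; have [sF _ _] := hF s.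
rewrite (_ : xi r.+1 = fun w => g r.+1 w - mu r.+1 w); last first.
  by apply/funext => w; rewrite gE addrC addKr.
apply/adapted_measurable_fun => //; apply: measurable_funB;
  apply/adapted_measurable_fun => //.
- exact: adapted_sub (filtration_le rs) gF.
- exact: adapted_sub (filtration_le (ltnW rs)) muF.
Qed.

Lemma integrable_drift k : (0 < k)%N -> P.-integrable setT (EFin \o mu k).
Proof. by case: k => // k _; have [_ /(_ k)[_ _ []]] := hmodel. Qed.

Lemma sigma_algebra_drift t : sigma_algebra setT (drift_sigma mu t).
Proof. exact: smallest_sigma_algebra. Qed.

Lemma drift_sigma_measurable t : drift_sigma mu t `<=` measurable.
Proof.
apply: smallest_sub; first exact: sigma_algebra_measurable.
move=> A [k /andP[k0 _]] [Y mY <-].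
have mmu : measurable_fun setT (mu k).
  exact/measurable_EFinP/(measurable_int P)/integrable_drift.
exact: mmu.
Qed.

Lemma adapted_drift k t : (0 < k <= t)%N -> adapted (drift_sigma mu t) (mu k).
Proof. by move=> kt A muA; apply: sub_sigma_algebra; exists k. Qed.

(** The moments are first computed given [F 0], then integrated over the whole space. *)
Lemma expectation_noise_sum c t :
  let N w := \sum_(k < t) c k * xi (t - k)%N w in
  ('E_P[N] = 0)%E /\
  ('E_P[(fun w => N w ^+ 2)%R] = (sigma ^+ 2 * \sum_(k < t) c k ^+ 2)%:E)%E.
Proof.
move=> N; have [hF hM] := hmodel.
have [sF0 F0m _] := hF 0%N.
have F0T : F 0%N setT.
  by have [F00 FC _] := sF0; rewrite -(setD0 setT); exact: FC.
have [||] := @cond_moments_noise_sum _ _ _ P F (F 0%N) xi sigma t c sF0 F0m.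
- by move=> s _; have [? ? _] := hF s; have [_ _ _ ? ?] := hM s; split=> //;
    exact: filtration_le.
- by move=> r s /andP[rs _]; exact: adapted_noise.
move=> [_ _ _ N1] [_ _ _ N2]; split; first by rewrite unlock N1// integral0.
by rewrite -(expectation_cst P) unlock N2.
Qed.

(** * Moments conditional on the drift *)

Hypothesis hnoise : noise_model_given_drift P F mu xi sigma.

(** [M] is measurable for the drifts and [N] has conditional mean zero, so [M] is the conditional
    mean of [X] and the variance of [X] is the second moment of [N]. *)
Lemma cond_moments_given_drift c t (X : Omega -> R) :
  let M w := \sum_(k < t) c k * mu (t - k)%N w in
  let N w := \sum_(k < t) c k * xi (t - k)%N w in
  (forall w, X w = M w + N w) ->
  [/\ is_cond_exp P (drift_sigma mu t) X M,
      forall E, is_cond_exp P (drift_sigma mu t) X E ->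
        {ae P, forall w, X w - E w = N w}
    & is_cond_var P (drift_sigma mu t) X
        (cst (sigma ^+ 2 * \sum_(k < t) c k ^+ 2))].
Proof.
move=> M N XE; have [hF hM] := hmodel.
have sS := sigma_algebra_drift t; have Sm := @drift_sigma_measurable t.
(* The enlarged pasts contain both the drifts up to [t] and the earlier noise. *)
have [||N1 N2] := @cond_moments_noise_sum _ _ _ P
    (fun s => <<s F s `|` drift_sigma mu t >>) _ xi sigma t c sS Sm.
- move=> s st; have [? ?] := hnoise st; split=> //.
  + apply: smallest_sub; first exact: sigma_algebra_measurable.
    by rewrite subUset; split => //; have [] := hF s.
  + by apply: subset_trans (@sub_sigma_algebra _ _ _); exact: subsetUr.
- move=> r s /andP[rs _]; apply: adapted_sub (adapted_noise rs).
  by apply: subset_trans (@sub_sigma_algebra _ _ _); exact: subsetUl.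
have M1 : is_cond_exp P (drift_sigma mu t) M M.
  apply: cond_exp_sum => // k.
  have tk : (0 < t - k <= t)%N by have := ltn_ord k; lia.
  have imu : P.-integrable setT (EFin \o (fun w => c k * mu (t - k)%N w)).
    apply: (@integrableZl _ _ _ P setT measurableT (c k) (EFin \o mu (t - k)%N)).
    by apply: integrable_drift; case/andP: tk.
  split=> //; apply/adapted_measurable_fun => //; apply: measurable_funM => //.
  by apply/adapted_measurable_fun => //; exact: adapted_drift.
have X1 : is_cond_exp P (drift_sigma mu t) X M.
  have := cond_exp_lin 1 1 sS Sm M1 N1.
  under eq_fun do rewrite !mul1r -XE.
  by under [X in is_cond_exp _ _ _ X]eq_fun do rewrite !mul1r addr0.
have XMN w : X w - M w = N w by rewrite XE addrC addKr.
split=> // [E XE'|].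
  by apply: filterS (cond_exp_unique sS Sm X1 XE') => w <-.
by exists M => //; under eq_fun do rewrite XMN.
Qed.

End gradient_model.

(** * Variances of the two momentum estimators, their limits and their ratio *)

Theorem mainTheorem9 (R : realType) (d : measure_display)
    (Omega : measurableType d) (P : probability Omega R)
    (F : nat -> set_system Omega) (g mu xi : nat -> Omega -> R)
    (eta sigma : R) (heta : 0 < eta < 1)
    (hmodel : gradient_model P F g mu xi sigma) :
  let v := single_momentum eta g in
  let u := double_momentum eta g in
  let Sigma := drift_sigma mu in
  let vmean t w := eta * \sum_(k < t) (1 - eta) ^+ k * mu (t - k)%N w in
  let umean t w := eta ^+ 2 *
    \sum_(r < t) r.+1%:R * (1 - eta) ^+ r * mu (t - r)%N w in
  let vnoise t w := eta * \sum_(k < t) (1 - eta) ^+ k * xi (t - k)%N w in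
  let unoise t w := eta ^+ 2 *
    \sum_(r < t) r.+1%:R * (1 - eta) ^+ r * xi (t - r)%N w in
  let vvar t := eta ^+ 2 * sigma ^+ 2 *
    \sum_(k < t) (1 - eta) ^+ (2 * k) in
  let uvar t := eta ^+ 4 * sigma ^+ 2 *
    \sum_(r < t) r.+1%:R ^+ 2 * (1 - eta) ^+ (2 * r) in
  let vvar_lim := eta / (2 - eta) * sigma ^+ 2 in
  let uvar_lim :=
    sigma ^+ 2 * eta * ((2 - 2 * eta + eta ^+ 2) / (2 - eta) ^+ 3) in
  let ratio (e : R) : R := (2 - 2 * e + e ^+ 2) / (2 - e) ^+ 2 in
  [/\ (* consequences that need no assumption on the law of xi given mu *)
      forall t,
        [/\ forall w, v t w = vmean t w + vnoise t w,
            forall w, u t w = umean t w + unoise t w,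
            ('E_P[vnoise t] = 0)%E /\ ('E_P[unoise t] = 0)%E,
            ('E_P[(fun w => vnoise t w ^+ 2)%R] = (vvar t)%:E)%E
          & ('E_P[(fun w => unoise t w ^+ 2)%R] = (uvar t)%:E)%E],
      noise_model_given_drift P F mu xi sigma ->
        (* conditional means, centered noise parts, conditional variances *)
        (forall t,
          [/\ is_cond_exp P (Sigma t) (v t) (vmean t) /\
              is_cond_exp P (Sigma t) (u t) (umean t),
              forall Ev, is_cond_exp P (Sigma t) (v t) Ev ->
                {ae P, forall w, v t w - Ev w = vnoise t w},
              forall Eu, is_cond_exp P (Sigma t) (u t) Eu ->
                {ae P, forall w, u t w - Eu w = unoise t w},
              is_cond_var P (Sigma t) (v t) (cst (vvar t))
            & is_cond_var P (Sigma t) (u t) (cst (uvar t))]) /\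
        (* limits of the conditional variances, for any choice of versions *)
        (forall V U : nat -> Omega -> R,
          (forall t, is_cond_var P (Sigma t) (v t) (V t)) ->
          (forall t, is_cond_var P (Sigma t) (u t) (U t)) ->
          {ae P, forall w,
            [/\ V t w @[t --> \oo] --> vvar_lim,
                U t w @[t --> \oo] --> uvar_lim
              & sigma != 0 ->
                limn (fun t => U t w) / limn (fun t => V t w) = ratio eta /\
                limn (fun t => U t w) < limn (fun t => V t w)]}),
      2^-1 <= ratio eta < 1
    & ratio e @[e --> 0^'+] --> (2^-1 : R)].
Proof.
move=> v u Sigma vmean umean vnoise unoise vvar uvar vvar_lim uvar_lim ratio.
have /andP[eta0 eta1] := heta.
(* Common ratio of both variance series; [1 - q = eta (2 - eta)]. *)
pose q := (1 - eta) ^+ 2.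
have q01 : 0 < q < 1.
  by rewrite exprn_gt0 ?subr_gt0// exprn_ilt1 ?subr_ge0 ?(ltW eta1)//; lra.
have eta_neq2 : 2 - eta != 0 by rewrite gt_eqF//; lra.
have q_neq1 : 1 - (1 - eta) ^+ 2 != 0.
  by have /andP[_ q1] := q01; rewrite subr_eq0 gt_eqF.
(* The prefactors are absorbed into the coefficients, which puts both estimators in the form
   [\sum c k * x (t - k)] of the general lemmas. *)
pose cv k := eta * (1 - eta) ^+ k.
pose cu k := eta ^+ 2 * (k.+1%:R * (1 - eta) ^+ k).
have vsum (x : nat -> Omega -> R) t :
    (fun w => eta * \sum_(k < t) (1 - eta) ^+ k * x (t - k)%N w) =
    (fun w => \sum_(k < t) cv k * x (t - k)%N w).
  by apply/funext => w; rewrite mulr_sumr; under eq_bigr do rewrite mulrA.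
have usum (x : nat -> Omega -> R) t :
    (fun w => eta ^+ 2 *
       \sum_(r < t) r.+1%:R * (1 - eta) ^+ r * x (t - r)%N w) =
    (fun w => \sum_(r < t) cu r * x (t - r)%N w).
  by apply/funext => w; rewrite mulr_sumr; under eq_bigr do rewrite mulrA.
have vmeanE t : vmean t = fun w => \sum_(k < t) cv k * mu (t - k)%N w.
  exact: vsum.
have umeanE t : umean t = fun w => \sum_(k < t) cu k * mu (t - k)%N w.
  exact: usum.
have vnoiseE t : vnoise t = fun w => \sum_(k < t) cv k * xi (t - k)%N w.
  exact: vsum.
have unoiseE t : unoise t = fun w => \sum_(k < t) cu k * xi (t - k)%N w.
  exact: usum.
have vvarE t : vvar t = sigma ^+ 2 * \sum_(k < t) cv k ^+ 2.
  rewrite /vvar [eta ^+ 2 * _]mulrC -mulrA mulr_sumr; congr (_ * _).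
  by apply: eq_bigr => k _; rewrite exprMn -exprM mulnC.
have uvarE t : uvar t = sigma ^+ 2 * \sum_(k < t) cu k ^+ 2.
  rewrite /uvar [eta ^+ 4 * _]mulrC -mulrA mulr_sumr; congr (_ * _).
  by apply: eq_bigr => k _; rewrite !exprMn -!exprM [(k * 2)%N]mulnC -exprD.
have gE t w : g t.+1 w = mu t.+1 w + xi t.+1 w.
  by have [_ /(_ t)[_ ->]] := hmodel.
have gsum (c : nat -> R) t w : \sum_(k < t) c k * g (t - k)%N w =
    \sum_(k < t) c k * mu (t - k)%N w + \sum_(k < t) c k * xi (t - k)%N w.
  rewrite -big_split; apply: eq_bigr => k _ /=.
  have -> : (t - k)%N = (t - k).-1.+1 by have := ltn_ord k; lia.
  by rewrite -mulrDr gE.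
have vE t w : v t w = vmean t w + vnoise t w.
  by rewrite /v single_momentumE -mulrDr gsum.
have uE t w : u t w = umean t w + unoise t w.
  rewrite /u double_momentumE -mulrDr.
  by rewrite (gsum (fun r => r.+1%:R * (1 - eta) ^+ r)).
have cvg_vvar : vvar t @[t --> \oo] --> vvar_lim.
  rewrite (_ : vvar_lim = eta ^+ 2 * sigma ^+ 2 * (1 - q)^-1); last first.
    rewrite /vvar_lim /q; by field; rewrite ?eta_neq2 ?q_neq1.
  apply: cvgM; first exact: cvg_cst.
  under eq_fun do under eq_bigr do rewrite exprM.
  exact: cvg_sum_geometric.
(* Here [1 + q = 2 - 2 eta + eta^2], and the factor [eta^3] of [(1 - q)^3] cancels against
   [eta^4]. *)
have cvg_uvar : uvar t @[t --> \oo] --> uvar_lim.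
  rewrite (_ : uvar_lim =
      eta ^+ 4 * sigma ^+ 2 * ((1 + q) / (1 - q) ^+ 3)); last first.
    rewrite /uvar_lim /q; by field; rewrite ?eta_neq2 ?q_neq1.
  apply: cvgM; first exact: cvg_cst.
  under eq_fun do under eq_bigr do rewrite exprM.
  exact: cvg_sum_sqr_geometric.
have ratio_eta : 2^-1 <= ratio eta < 1.
  have d0 : 0 < (2 - eta) ^+ 2 by rewrite exprn_gt0//; lra.
  rewrite /ratio ler_pdivlMr// ltr_pdivrMr// mul1r.
  (* After clearing denominators the lower bound is [eta^2 >= 0] and the upper one
     [2 - 2 eta > 0]. *)
  by apply/andP; split; nra.
have lim_ratio : uvar_lim = ratio eta * vvar_lim.
  rewrite /uvar_lim /vvar_lim /ratio; by field; rewrite ?eta_neq2 ?q_neq1.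
split => //.
- move=> t; split=> //.
  + rewrite vnoiseE unoiseE.
    by split; [have [] := expectation_noise_sum hmodel cv t|
              have [] := expectation_noise_sum hmodel cu t].
  + by rewrite vnoiseE vvarE; have [] := expectation_noise_sum hmodel cv t.
  + by rewrite unoiseE uvarE; have [] := expectation_noise_sum hmodel cu t.
- move=> hnoise.
  have cond_v t : [/\ is_cond_exp P (Sigma t) (v t) (vmean t),
      forall E, is_cond_exp P (Sigma t) (v t) E ->
        {ae P, forall w, v t w - E w = vnoise t w}
    & is_cond_var P (Sigma t) (v t) (cst (vvar t))].
    rewrite vmeanE vnoiseE vvarE.
    apply: (cond_moments_given_drift hmodel) => // w.
    by rewrite vE vmeanE vnoiseE.
  have cond_u t : [/\ is_cond_exp P (Sigma t) (u t) (umean t),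
      forall E, is_cond_exp P (Sigma t) (u t) E ->
        {ae P, forall w, u t w - E w = unoise t w}
    & is_cond_var P (Sigma t) (u t) (cst (uvar t))].
    rewrite umeanE unoiseE uvarE.
    apply: (cond_moments_given_drift hmodel) => // w.
    by rewrite uE umeanE unoiseE.
  split=> [t|V U hV hU].
    by have [? ? ?] := cond_v t; have [? ? ?] := cond_u t.
  have sS t : sigma_algebra setT (Sigma t) by exact: sigma_algebra_drift.
  have Sm t : Sigma t `<=` measurable by exact: drift_sigma_measurable hmodel t.
  (* Countably many null sets, one for each [t], are merged into one, so that the limit can be taken
     pointwise outside it. *)
  have aeV : {ae P, forall w, forall t, V t w = vvar t}.
    apply: ae_foralln => t; have [_ _ cvv] := cond_v t.
    exact: cond_var_unique (hV t) cvv.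
  have aeU : {ae P, forall w, forall t, U t w = uvar t}.
    apply: ae_foralln => t; have [_ _ cvu] := cond_u t.
    exact: cond_var_unique (hU t) cvu.
  apply: filterS2 aeV aeU => w Vw Uw.
  rewrite (_ : (fun t => V t w) = vvar); last exact/funext.
  rewrite (_ : (fun t => U t w) = uvar); last exact/funext.
  split=> // sigma0.
  rewrite (cvg_lim _ cvg_vvar)// (cvg_lim _ cvg_uvar)// lim_ratio.
  (* [sigma != 0] makes the limit positive, which permits the division and makes the inequality
     strict. *)
  have vlim0 : 0 < vvar_lim.
    rewrite mulr_gt0 ?divr_gt0 ?exprn_even_gt0//; lra.
  have /andP[_ ratio1] := ratio_eta.
  by rewrite mulfK ?gt_eqF// gtr_pMl.
(* The ratio is continuous at 0, where its value is 1/2. *)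
- rewrite (_ : 2^-1 = ratio 0); last by rewrite /ratio; field.
  apply: cvg_at_right_filter; rewrite /ratio.
  under eq_fun do rewrite !expr2; rewrite !expr2.
  have cB : 2 - e @[e --> (0 : R)] --> 2 - (0 : R).
    by apply: cvgB; [exact: cvg_cst|exact: cvg_id].
  apply: cvgM.
    apply: cvgD; last by apply: cvgM; exact: cvg_id.
    apply: cvgB; first exact: cvg_cst.
    by apply: cvgM; [exact: cvg_cst|exact: cvg_id].
  by apply: cvgV; [rewrite subr0 mulf_neq0|exact: cvgM].
Qed.
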